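(* Let $p$ be a prime and let $G$ be a finite VZ $p$-group (in particular $G$ is non-abelian). Then $\mathrm{cod}(G) = \mathrm{cod}_{\mathrm{lin}}(G) \cup \mathrm{cod}_{\mathrm{nl}}(G)$, where $$\mathrm{cod}_{\mathrm{lin}}(G) = \{ p^i : i = 0, 1, \ldots, \log_{p}(\exp(G/G')) \}$$ and $$\mathrm{cod}_{\mathrm{nl}}(G) = \left\{ |G/Z(G)|^{1/2} \left| \frac{Z(G)}{N} \right| : N \lneq Z(G) \text{ such that } G' \nleq N \text{ and } \frac{Z(G)}{N} \text{ is cyclic} \right\}.$$
   Context: For an irreducible complex character $\chi$ of a finite group $G$, its codegree is $\mathrm{cod}(\chi) = |G:\ker\chi|/\chi(1)$. $\mathrm{cod}(G)$, $\mathrm{cod}_{\mathrm{lin}}(G)$ and $\mathrm{cod}_{\mathrm{nl}}(G)$ denote the sets of codegrees of all irreducible characters, all linear characters, and all nonlinear irreducible characters of $G$, respectively. A finite non-abelian $p$-group $G$ is called a VZ $p$-group if every nonlinear irreducible complex character of $G$ vanishes on $G\setminus Z(G)$. $G'$ is the commutator subgroup and $\exp$ the exponent; $N \lneq Z(G)$ means $N$ is a proper subgroup of $Z(G)$. *)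

(* Defs.v *)
From HB Require Import structures.
From mathcomp Require Import all_boot all_order all_algebra all_fingroup.
From mathcomp Require Import all_solvable all_field all_character.

Set Implicit Arguments.
Unset Strict Implicit.
Unset Printing Implicit Defensive.

Import GroupScope GRing.Theory Num.Theory.
Local Open Scope ring_scope.

(* Codegrees are taken in algC, where the quotient by chi 1 is exact. The     *)
(* finite sets of codegrees are represented by sequences, to be compared by   *)
(* membership only (=i), so order and multiplicity are irrelevant.            *)

Definition codegree (gT : finGroupType) (G : {group gT}) (chi : 'CF(G)) : algC :=
  #|G : cfker chi|%:R / chi 1%g.

Definition cod (gT : finGroupType) (G : {group gT}) : seq algC :=
  [seq codegree chi | chi <- irr G].

Definition cod_lin (gT : finGroupType) (G : {group gT}) : seq algC :=
  [seq codegree chi | chi : 'CF(G) <- irr G & chi \is a linear_char].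

Definition cod_nl (gT : finGroupType) (G : {group gT}) : seq algC :=
  [seq codegree chi | chi : 'CF(G) <- irr G & chi \isn't a linear_char].

Definition VZ_pgroup (p : nat) (gT : finGroupType) (G : {group gT}) : Prop :=
  [/\ p.-group G, ~~ abelian G
    & forall chi : 'CF(G), chi \in irr G -> chi \isn't a linear_char ->
        forall g, g \in G :\: 'Z(G) -> chi g = 0].

(* Main.v *)
(* A linear character has codegree equal to its order, and the linear          *)
(* characters form a group of exponent exp(G/G').                              *)
(* A nonlinear irreducible chi vanishing off Z(G) has Z(chi) = Z(G), hence     *)
(* chi(1)^2 = |G : Z(G)|, ker chi <= Z(G), and Z(G) / ker chi is cyclic.       *)
(* Conversely, if Z(G) / N is cyclic, then N is the kernel of some lambda in   *)
(* Irr(Z(G)). As G' <= Z(G) and G' is not in N, any irreducible chi over       *)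
(* lambda is nonlinear and has kernel N.                                       *)
Require Import Defs.
From HB Require Import structures.
From mathcomp Require Import all_boot all_order all_algebra all_fingroup.
From mathcomp Require Import all_solvable all_field all_character.

Set Implicit Arguments.
Unset Strict Implicit.
Unset Printing Implicit Defensive.

Import GroupScope GRing.Theory Num.Theory.
Local Open Scope ring_scope.

(** On the nonlinear side everything is read off ['Z(G)]: [codegree_vanishing] expresses the
    codegree through the kernel alone, and [VZ_ex_irr_ker] realises each admissible kernel. Both
    directions use that G' is central ([VZ_der1_sub_center]), a consequence of column
    orthogonality. *)

Lemma lin_char_codegree (gT : finGroupType) (G : {group gT}) (chi : 'CF(G)) :
  chi \is a linear_char -> codegree chi = #[chi]%CF%:R.
Proof.
move=> lin_chi; have Zchi: 'Z(chi)%CF = G.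
  apply/eqP; rewrite eqEsubset cfcenter_sub; apply/subsetP=> x Gx.
  by rewrite char_cfcenterE ?lin_charW // normC_lin_char // lin_char1.
(* The order of [chi] is the exponent of G / ker chi, which equals its cardinal as Z(chi) / ker chi
   is cyclic. *)
rewrite /codegree lin_char1 // divr1 cforder_lin_char //.
rewrite exponent_cyclic ?card_quotient ?cfker_norm //.
by have := cfcenter_cyclic chi; rewrite Zchi.
Qed.

Lemma lin_char_cforder_dvd (gT : finGroupType) (G : {group gT}) (chi : 'CF(G)) :
  chi \is a linear_char -> (#[chi]%CF %| exponent (G / G^`(1))%g)%N.
Proof.
move=> lin_chi; apply/dvdn_cforderP=> x Gx.
have nG'x: x \in 'N(G^`(1)) by rewrite (subsetP (der_norm 1 G)).
rewrite -lin_charX // -(lin_char1 lin_chi) cfker1 //.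
rewrite (subsetP (lin_char_der1 lin_chi)) // coset_idr ?groupX //.
by rewrite morphX //= expg_exponent ?mem_quotient.
Qed.

(* The linear characters form an abelian group, so its exponent is attained;   *)
(* as they separate the points of G / G', this exponent is that of G / G'.     *)
Lemma ex_lin_char_cforder (gT : finGroupType) (G : {group gT}) (n : nat) :
    (n %| exponent (G / G^`(1))%g)%N ->
  exists2 chi : 'CF(G), chi \is a linear_char & #[chi]%CF = n.
Proof.
have [linG [cF [injF _ linF exF] [_ mulF expF _ ordF]]] := lin_char_group G.
have nilG: nilpotent [set: linG].
  apply/abelian_nil/centsP=> u _ v _; apply: injF.
  by rewrite !mulF mulrC.
have [u _ def_u] := exponent_witness nilG => n_dvd.
have dvd_u: (exponent (G / G^`(1))%g %| #[u]%g)%N.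
  apply/exponentP=> _ /morphimP[x nG'x Gx ->].
  rewrite -morphX //= coset_id // -cap_cfker_lin_irr; apply/bigcapP=> i lin_i.
  rewrite cfkerEirr inE lin_charX // lin_char1 //.
  have [v ->] := exF _ lin_i; apply/eqP; move: x Gx {nG'x}; apply/dvdn_cforderP.
  by rewrite ordF -def_u dvdn_exponent ?inE.
have n_u := dvdn_trans n_dvd dvd_u.
have n_gt0 := dvdn_gt0 (order_gt0 u) n_u.
exists (cF (u ^+ (#[u] %/ n))%g); rewrite ?linF // ordF.
by rewrite orderXdiv ?dvdn_div // divnA // mulKn.
Qed.

(** On Z(chi) the modulus of chi is chi(1), which is nonzero. *)
Lemma cfcenter_vanishing (gT : finGroupType) (G : {group gT}) (i : Iirr G) :
    (forall g, g \in G :\: 'Z(G) -> 'chi_i g = 0) ->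
  'Z('chi_i)%CF = 'Z(G).
Proof.
move=> chi0; apply/eqP; rewrite eqEsubset; apply/andP; split; last first.
  by rewrite -cap_cfcenter_irr (bigcap_inf i).
apply/subsetP=> x Zx; have Gx := subsetP (cfcenter_sub _) x Zx.
apply: contraLR Zx => nZx; rewrite irr_cfcenterE // chi0 ?in_setD ?nZx //.
by rewrite normr0 eq_sym irr1_neq0.
Qed.

Lemma codegree_vanishing (gT : finGroupType) (G : {group gT}) (i : Iirr G) :
    (forall g, g \in G :\: 'Z(G) -> 'chi_i g = 0) ->
  codegree 'chi_i
    = sqrtC #|(G / 'Z(G))%g|%:R * #|('Z(G) / cfker 'chi_i)%g|%:R.
Proof.
move=> chi0; have Zchi := cfcenter_vanishing chi0.
have nKZ: cfker 'chi_i <| 'Z(G) by rewrite -Zchi cfker_center_normal.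
(* Vanishing off Z(chi) is the equality case of chi(1)^2 <= |G : Z(chi)|. *)
have sqr_chi1: 'chi_i 1%g ^+ 2 = #|G : 'Z(G)|%:R.
  apply/eqP; rewrite -Zchi irr1_bound; apply/cfun_onP=> x.
  rewrite Zchi => nZx; have [Gx | /cfun0-> //] := boolP (x \in G).
  by rewrite chi0 // in_setD nZx.
have chi1_ge0: 0 <= 'chi_i 1%g by rewrite Order.POrderTheory.ltW ?irr1_gt0.
rewrite !card_quotient ?normal_norm ?center_normal // -sqr_chi1 sqrCK //.
rewrite /codegree -(Lagrange_index (center_sub G) (normal_sub nKZ)) natrM.
by rewrite -sqr_chi1 expr2 mulrAC -!mulrA mulVKf ?irr1_neq0.
Qed.

(* Column orthogonality of g in G' against 1: if all nonlinear characters      *)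
(* vanish at g, the sum counts the linear characters, so g = 1.                *)
Lemma der1_vanishing_eq1 (gT : finGroupType) (G : {group gT}) (g : gT) :
    g \in G^`(1)%g ->
    (forall i : Iirr G, 'chi_i \isn't a linear_char -> 'chi_i g = 0) ->
  g = 1%g.
Proof.
move=> G'g chi0; apply/eqP; apply: contraT => nt_g.
have := second_orthogonality_relation g (group1 G).
rewrite class1G inE (negbTE nt_g) mulr0n.
rewrite (bigID (fun i => 'chi[G]_i \is a linear_char)) /=.
rewrite [X in _ + X]big1 => [|i nlin_i]; last by rewrite chi0 // mul0r.
rewrite addr0 (eq_bigr (fun=> 1)) => [|i lin_i]; last first.
  rewrite cfker1 ?(subsetP (lin_char_der1 lin_i)) //.
  by rewrite lin_char1 // conjC1 mulr1.
rewrite sumr_const => /eqP; rewrite pnatr_eq0 card_lin_irr.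
by rewrite -leqn0 leqNgt indexg_gt0.
Qed.

Lemma VZ_der1_sub_center (p : nat) (gT : finGroupType) (G : {group gT}) :
  VZ_pgroup p G -> G^`(1)%g \subset 'Z(G).
Proof.
case=> _ _ VZ; apply/subsetP=> g G'g; apply: contraT => nZg.
have Gg := subsetP (der_sub 1 G) g G'g.
suff g1: g = 1%g by rewrite g1 group1 in nZg.
apply: (der1_vanishing_eq1 G'g) => i nlin_i.
by apply: VZ; rewrite ?mem_irr // in_setD nZg.
Qed.

(** A [p]-group with cyclic centre has a faithful irreducible character; lift one from G / N. *)
Lemma pgroup_ex_irr_ker (p : nat) (gT : finGroupType) (G N : {group gT}) :
    p.-group G -> N <| G -> cyclic 'Z(G / N)%g ->
  exists i : Iirr G, cfker 'chi_i = N.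
Proof.
move=> pG nsNG cycZ.
have [i /trivgP ker_i] := pgroup_cyclic_faithful (quotient_pgroup N pG) cycZ.
exists (mod_Iirr i); rewrite mod_IirrE // cfker_morph ?normal_norm // ker_i.
by rewrite -kerE ker_coset; apply/setIidPr/normal_sub.
Qed.

Lemma cfRes_sub_cfcenter (gT : finGroupType) (G H : {group gT}) (chi : 'CF(G)) :
    H \subset 'Z(chi)%CF ->
  exists2 lambda : 'CF(H),
    lambda \is a linear_char & 'Res[H] chi = chi 1%g *: lambda.
Proof.
move=> sHZ; have [lambda lin_lambda def_chi] := cfcenter_Res chi.
exists ('Res[H] lambda); first exact: cfRes_lin_char.
by rewrite -linearZ -def_chi /= cfResRes ?cfcenter_sub.
Qed.

Lemma VZ_ex_irr_ker (p : nat) (gT : finGroupType) (G N : {group gT}) :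
    VZ_pgroup p G -> N \subset 'Z(G) -> ~~ (G^`(1)%g \subset N) ->
    cyclic ('Z(G) / N)%g ->
  exists2 i : Iirr G, 'chi_i \isn't a linear_char & cfker 'chi_i = N.
Proof.
move=> VZ_G sNZ nG'N cycZN; have [pG _ VZ] := VZ_G.
have sZG := center_sub G; have sG'Z := VZ_der1_sub_center VZ_G.
have [j ker_j]: exists j : Iirr 'Z(G), cfker 'chi_j = N.
  apply: (pgroup_ex_irr_ker (pgroupS sZG pG)).
    by rewrite -sub_abelian_normal ?center_abelian.
  exact: cyclicS (center_sub _) cycZN.
have [i] := constt_cfInd_irr j sZG; rewrite constt_Ind_Res => Res_i_j.
have nlin_i: 'chi_i \isn't a linear_char.
  (* If ['chi_i] were linear, G' would lie in its kernel, hence in the kernel N of the constituent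
     ['chi_j] of its restriction. *)
  apply: contra nG'N => /lin_char_der1 sG'K; rewrite -ker_j.
  apply: subset_trans (cfker_constt _ Res_i_j); last first.
    by rewrite cfRes_char ?irr_char.
  by rewrite cfker_Res ?irr_char // subsetI sG'Z.
exists i => //.
have Zchi: 'Z('chi_i)%CF = 'Z(G).
  by apply: cfcenter_vanishing => g; apply: VZ; rewrite ?mem_irr.
have [|lambda lin_lambda Res_i] := @cfRes_sub_cfcenter _ G 'Z(G)%G 'chi_i.
  by rewrite Zchi.
(* The restriction is a multiple of [lambda], so [lambda] is its only constituent. *)
have def_j: 'chi_j = lambda.
  have /irrP[k def_k] := lin_char_irr lin_lambda; rewrite def_k.
  move: Res_i_j; rewrite Res_i def_k irr_consttE cfdotZl mulf_eq0 negb_or.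
  by case/andP=> _; rewrite -irr_consttE constt_irr => /eqP->.
have <-: 'Z(G) :&: cfker 'chi_i = cfker 'chi_i.
  by apply/setIidPr; rewrite -Zchi normal_sub ?cfker_center_normal.
by rewrite -cfker_Res ?irr_char // Res_i cfker_scale_nz ?irr1_neq0 // -def_j.
Qed.

Theorem mainTheorem3 (p : nat) (gT : finGroupType) (G : {group gT})
    (p_prime : prime p) (G_VZ : VZ_pgroup p G) :
  [/\ cod G =i [predU cod_lin G & cod_nl G],
      cod_lin G =i
        [seq (p ^ i)%N%:R : algC
           | i <- iota 0 (trunc_log p (exponent (G / G^`(1))%g)).+1]
    & cod_nl G =i
        [seq sqrtC #|(G / 'Z(G))%g|%:R * #|('Z(G) / N)%g|%:R
           | N : {group gT} in [set N : {group gT} | [&& N \proper 'Z(G),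
                     ~~ (G^`(1)%g \subset N) & cyclic ('Z(G) / N)%g]]]].
Proof.
have [pG _ VZ] := G_VZ; split=> x.
- rewrite inE /= /cod /cod_lin /cod_nl -mem_cat -map_cat.
  by apply: eq_mem_map => chi; rewrite mem_cat !mem_filter -andb_orl orbN.
- have /p_natP[e def_e]: p.-nat (exponent (G / G^`(1))%g).
    by rewrite pnat_exponent quotient_pgroup.
  rewrite def_e trunc_expnK ?prime_gt1 //.
  apply/mapP/mapP=> [[chi] | [i]].
    rewrite mem_filter => /andP[lin_chi _] ->.
    have := lin_char_cforder_dvd lin_chi; rewrite def_e.
    case/(dvdn_pfactor _ _ p_prime)=> i le_i def_i; exists i.
      by rewrite mem_iota ltnS.
    by rewrite lin_char_codegree // def_i.
  rewrite mem_iota ltnS /= => le_i ->.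
  have [|chi lin_chi ord_chi] := @ex_lin_char_cforder _ G (p ^ i).
    by rewrite def_e dvdn_exp2l.
  exists chi; first by rewrite mem_filter lin_chi lin_char_irr.
  by rewrite lin_char_codegree // ord_chi.
apply/mapP/imageP=> [[chi] | [N]].
  rewrite mem_filter => /andP[nlin_chi /irrP[i def_chi]] ->.
  rewrite {chi}def_chi in nlin_chi *.
  have chi0 g : g \in G :\: 'Z(G) -> 'chi_i g = 0 by apply: VZ; rewrite ?mem_irr.
  have Zchi := cfcenter_vanishing chi0.
  exists (cfker_group 'chi_i); last exact: codegree_vanishing.
  rewrite inE /= -lin_irr_der1 nlin_chi -Zchi cfcenter_cyclic.
  rewrite !andbT properEneq normal_sub ?cfker_center_normal // andbT.
  (* A kernel equal to ['Z(G)] would contain G', making the character linear. *)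
  apply: contra nlin_chi => /eqP eqKZ.
  rewrite lin_irr_der1 (subset_trans (VZ_der1_sub_center G_VZ)) //.
  by rewrite -Zchi eqKZ.
rewrite inE => /and3P[/proper_sub sNZ nG'N cycZN] ->.
have [i nlin_i keri] := VZ_ex_irr_ker G_VZ sNZ nG'N cycZN.
exists 'chi_i; first by rewrite mem_filter nlin_i mem_irr.
rewrite codegree_vanishing ?keri // => g; apply: VZ; rewrite ?mem_irr //.
Qed.
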